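(* Let $a>0$ be a fixed real number. Let $\mathbb{X}=(X_n,n\ge 1)$ be a strictly stationary sequence of random variables on a probability space $(\Omega,\mathcal{F},\mathbb{P})$ and let $(k_n,n\ge1)$ be a sequence of integers with $1\le k_n\le n$ for all $n$ and $\lim_{n\to\infty}k_n/n=1$. Assume that $$\mathbb{P}\big(X_1=\gamma_1(X_1|\mathcal{I}^{\mathbb{X}})\big)=0\quad\text{and}\quad\mathbb{P}\big(X_1=\gamma_1(X_1|\mathcal{I}^{\mathbb{X}})-a\big)=0.$$ Let $(N(t),t\ge0)$ be a process of non-negative integer-valued random variables on $(\Omega,\mathcal{F},\mathbb{P})$. If $N(t)\to\infty$ almost surely (respectively, in probability) as $t\to\infty$, then, as $t\to\infty$, $$\frac{\mathcal{K}_t(k_{N(t)},a)}{N(t)}\longrightarrow I\big(\gamma_1(X_1|\mathcal{I}^{\mathbb{X}})<\infty\big)\cdot\mathbb{P}\big(X_1>\gamma_1(X_1|\mathcal{I}^{\mathbb{X}})-a\,\big|\,\mathcal{I}^{\mathbb{X}}\big)$$ almost surely (respectively, in probability).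
   Context: $\mathcal{I}^{\mathbb{X}}$ is the sigma-field of sets invariant with respect to $\mathbb{X}$, i.e. of all $A\subseteq\Omega$ for which there is a Borel set $B\in\mathcal{B}(\mathbb{R}^{\mathbb{N}})$ with $A=\{\omega\in\Omega:(X_i(\omega),X_{i+1}(\omega),\ldots)\in B\}$ for every $i\ge1$. An extended random variable is a measurable function with values in $[-\infty,\infty]$; the usual conventions $x\pm\infty=\pm\infty$, $x<\infty$ for $x\in\mathbb{R}$ apply. For a (real-valued) random variable $X$ on $(\Omega,\mathcal{F},\mathbb{P})$ and a sigma-field $\mathcal{G}\subseteq\mathcal{F}$, the conditional right endpoint of the support of $X$ given $\mathcal{G}$, denoted $\gamma_1(X|\mathcal{G})$, is an extended random variable $\underline{Q}_1$ such that (i) $\underline{Q}_1$ is $\mathcal{G}$-measurable; (ii) $\mathbb{P}(X\le\underline{Q}_1|\mathcal{G})=1$ a.s.; (iii) for any $\mathcal{G}$-measurable extended random variable $Q_1$ with $\mathbb{P}(X\le Q_1|\mathcal{G})=1$ a.s., one has $Q_1\ge\underline{Q}_1$ a.s. It exists and is unique up to almost sure equality. $X_{1:n}\le\cdots\le X_{n:n}$ are the order statistics of $X_1,\ldots,X_n$, and $\mathcal{K}_t(k_{N(t)},a)=\sum_{i=1}^{N(t)} I(X_{k_{N(t)}:N(t)}-a<X_i<X_{k_{N(t)}:N(t)})$, where $I(\cdot)$ is the indicator function and an empty sum (the case $N(t)=0$) equals $0$. The ratio $\mathcal{K}_t(k_{N(t)},a)/N(t)$ is taken to be $0$ when $N(t)=0$.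 $N(t)\to\infty$ in probability means $\mathbb{P}(N(t)\le D)\to0$ as $t\to\infty$ for every $D>0$. No independence between $(N(t))$ and $\mathbb{X}$ is assumed. *)

(* Defs.v *)
From HB Require Import structures.
From mathcomp Require Import all_boot all_order all_algebra.
From mathcomp Require Import all_classical all_reals all_analysis.
From mathcomp Require Import measurable_realfun.

Set Implicit Arguments.
Unset Strict Implicit.
Unset Printing Implicit Defensive.

Import Order.TTheory GRing.Theory Num.Theory.
Import numFieldNormedType.Exports.

Local Open Scope classical_set_scope.
Local Open Scope ring_scope.

(* Sequences are indexed from 0: [X i] stands for X_{i+1}. *)

(* B(R^N): the sigma-field generated by the coordinate maps. The product being
   countable and R second countable, it is also the Borel sigma-field of the
   product topology. *)
Definition borel_seq (R : realType) : set (set (nat -> R)) :=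
  <<s \bigcup_i preimage_set_system setT (fun x : nat -> R => x i) measurable >>.

Section stationarity.
Context d (T : measurableType d) (R : realType) (P : probability T R).
Variable X : nat -> {RV P >-> R}.

Definition shifted_path (i : nat) (w : T) : nat -> R := fun j => X (i + j)%N w.

Definition strictly_stationary : Prop :=
  forall (i : nat) (B : set (nat -> R)), borel_seq B ->
    P (shifted_path i @^-1` B) = P (shifted_path 0 @^-1` B).

Definition invariant_sigma_field : set (set T) :=
  [set A | exists2 B : set (nat -> R),
     borel_seq B & forall i : nat, A = shifted_path i @^-1` B].

End stationarity.

Section conditioning.
Context d (T : measurableType d) (R : realType) (P : probability T R).

(* [G] plays the role of a sub-sigma-field of the measurable sets of [T]. *)
Variable G : set (set T).

Definition measurable_wrt d' (U : measurableType d') (f : T -> U) : Prop :=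
  forall B : set U, measurable B -> G (f @^-1` B).

(* [p] is a version of P(A | G). *)
Definition is_cond_prob (A : set T) (p : T -> R) : Prop :=
  [/\ measurable_wrt p,
      P.-integrable setT (EFin \o p) &
      forall B : set T, G B -> (\int[P]_(w in B) (p w)%:E)%E = P (A `&` B)].

Definition cond_prob_eq1 (A : set T) : Prop :=
  exists2 p : T -> R, is_cond_prob A p & {ae P, forall w, p w = 1}.

(* [q] is a version of gamma_1(Y | G). *)
Definition is_cond_right_endpoint (Y : T -> R) (q : T -> \bar R) : Prop :=
  [/\ measurable_wrt q,
      cond_prob_eq1 [set w | ((Y w)%:E <= q w)%E] &
      forall q' : T -> \bar R, measurable_wrt q' ->
        cond_prob_eq1 [set w | ((Y w)%:E <= q' w)%E] ->
        {ae P, forall w, (q w <= q' w)%E}].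

End conditioning.

(* The k-th smallest (k counted from 1) of x 0, ..., x (n - 1). *)
Definition order_stat (R : realType) (x : nat -> R) (n k : nat) : R :=
  nth 0 (sort <=%R (mkseq x n)) k.-1.

Definition near_order_stat_count (R : realType) (a : R) (x : nat -> R)
    (n k : nat) : nat :=
  \sum_(i < n) (order_stat x n k - a < x i < order_stat x n k)%R.

Section convergence.
Context d (T : measurableType d) (R : realType) (P : probability T R).

Definition cvg_as (Y : R -> T -> R) (L : T -> R) : Prop :=
  {ae P, forall w, Y t w @[t --> +oo] --> L w}.

Definition cvg_in_prob (Y : R -> T -> R) (L : T -> R) : Prop :=
  forall e : R, 0 < e ->
    P [set w | e < `|Y t w - L w|] @[t --> +oo] --> 0%E.

Definition diverges_as (N : R -> T -> nat) : Prop :=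
  {ae P, forall w, N t w @[t --> +oo] --> \oo}.

Definition diverges_in_prob (N : R -> T -> nat) : Prop :=
  forall D : R, 0 < D -> P [set w | (N t w)%:R <= D] @[t --> +oo] --> 0%E.

End convergence.

(* Main.v *)
Require Import Defs.
From HB Require Import structures.
From mathcomp Require Import all_boot all_order all_algebra.
From mathcomp Require Import all_classical all_reals all_analysis.
From mathcomp Require Import measurable_realfun lra.

Set Implicit Arguments.
Unset Strict Implicit.
Unset Printing Implicit Defensive.

Import Order.TTheory GRing.Theory Num.Theory.
Import numFieldNormedType.Exports.

Local Open Scope classical_set_scope.
Local Open Scope ring_scope.

(** The order statistic of rank [k n] with [k n / n] tending to [1] converges
    almost surely to the conditional right endpoint [gamma] of the process.
    Where [gamma] is finite, the proportion of the sample in the window of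
    length [a] below the order statistic therefore has the same limit as the
    proportion in the window below [gamma], provided that no mass sits on the
    two ends of that window; where [gamma] is infinite, the window escapes to
    infinity and the proportion vanishes.

    These facts rest on one inequality, [ergodic_density]: on an invariant event
    where the values fall in a given set with upper density greater than [b],
    that set has conditional probability at least [b] on average. It follows
    from the maximal ergodic inequality ([maximal_ergodic]) for the shift on
    path space. It has three consequences.

    - Applied to a set and to its complement, it gives Birkhoff's theorem for
      events with any version of the conditional probability as limit
      ([ergodic_theorem_events]). The events may involve [gamma], since
      [gamma] is invariant.
    - If values at most [c < gamma] had upper density one on some invariant
      event, the process would be bounded by [c] on it, against the minimality
      of [gamma]. So they leave out a positive proportion of the sample
      ([below_endpoint_density]), and the order statistic ends up above [c].
    - Events decreasing to a null event have upper densities decreasing to zero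
      ([vanishing_upper_density]). This controls the values close to [gamma]
      and to [gamma - a], and the large values when [gamma] is infinite.

    Sandwiching the window of the order statistic gives the almost sure limit
    for deterministic sample sizes ([near_order_stat_ratio_cvg]). A random
    sample size that diverges almost surely is substituted pathwise; if it
    diverges in probability, almost sure convergence makes the deviations
    uniformly small beyond a large index, except on an event of small
    probability. *)

(** * The maximal ergodic inequality *)

Section maximal_ergodic.
Context d (E : measurableType d) (R : realType).
Variables (mu : {finite_measure set E -> \bar R}) (theta : E -> E).
Hypothesis mtheta : measurable_fun setT theta.
Hypothesis theta_preserves :
  forall A, measurable A -> mu (theta @^-1` A) = mu A.

Lemma integrable_comp_preserving (g : E -> R) : measurable_fun setT g ->
  mu.-integrable setT (EFin \o g) -> mu.-integrable setT (EFin \o (g \o theta)).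
Proof.
move=> mg /integrableP[_ ig]; apply/integrableP; split.
  by apply/measurable_EFinP; exact: measurableT_comp.
rewrite (_ : (\int[mu]_x _ = \int[mu]_x `|(EFin \o g) x|)%E) //.
have mag : measurable_fun setT (fun x => `|(EFin \o g) x|%E).
  by apply: measurableT_comp => //; exact/measurable_EFinP.
rewrite -[RHS](@eq_measure_integral _ _ _ _ _ (pushforward mu theta)).
  by rewrite ge0_integral_pushforward.
by move=> A mA _; exact: theta_preserves.
Qed.

Lemma integral_comp_preserving (g : E -> R) : measurable_fun setT g ->
  mu.-integrable setT (EFin \o g) ->
  (\int[mu]_x (g (theta x))%:E = \int[mu]_x (g x)%:E)%E.
Proof.
move=> mg ig.
rewrite -[RHS](@eq_measure_integral _ _ _ _ _ (pushforward mu theta)).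
  rewrite integral_pushforward//; first exact/measurable_EFinP.
  by rewrite preimage_setT; exact: integrable_comp_preserving.
by move=> A mA _; exact: theta_preserves.
Qed.

Variable f : E -> R.

(** The maximum over [j <= n] of the sum of [f] over the first [j] points of the
    orbit of [x]. The recursion peels off the first point of the orbit, so
    that comparing values at [x] and at [theta x] needs no reindexing. *)
Fixpoint max_orbit_sum (n : nat) (x : E) : R :=
  if n is m.+1 then Num.max 0 (f x + max_orbit_sum m (theta x)) else 0.

Lemma max_orbit_sum_ge0 n x : 0 <= max_orbit_sum n x.
Proof. by case: n => //= n; rewrite le_max lexx. Qed.

Lemma max_orbit_sum_leS n x : max_orbit_sum n x <= max_orbit_sum n.+1 x.
Proof.
elim: n x => [|n IH] x; first exact: (max_orbit_sum_ge0 1).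
have h : f x + max_orbit_sum n (theta x) <= f x + max_orbit_sum n.+1 (theta x).
  by rewrite lerD2l IH.
by rewrite [leRHS]/= ge_max le_max lexx /= le_max [X in _ || X]h orbT.
Qed.

Lemma orbit_sum_le_max n x :
  \sum_(i < n) f (iter i theta x) <= max_orbit_sum n x.
Proof.
elim: n x => [|n IH] x; first by rewrite big_ord0.
rewrite big_ord_recl /= le_max; apply/orP; right; rewrite lerD2l.
apply: le_trans (IH (theta x)); rewrite le_eqVlt; apply/orP; left.
apply/eqP/eq_bigr => i _.
by rewrite /= -iterSr.
Qed.

Hypotheses (mf : measurable_fun setT f)
  (intf : mu.-integrable setT (EFin \o f)).

Lemma measurable_max_orbit_sum n : measurable_fun setT (max_orbit_sum n).
Proof.
elim: n => [|n IH]; first exact: measurable_cst.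
rewrite (_ : max_orbit_sum n.+1 =
  (cst 0 \max (f \+ (max_orbit_sum n \o theta)))) //.
by apply: measurable_maxr => //; apply: measurable_funD => //;
  exact: measurableT_comp.
Qed.

Lemma integrable_max_orbit_sum n :
  mu.-integrable setT (EFin \o max_orbit_sum n).
Proof.
elim: n => [|n IH]; first exact: integrable0.
pose g := f \+ (max_orbit_sum n \o theta).
have ig : mu.-integrable setT (EFin \o g).
  rewrite (_ : EFin \o g =
    (EFin \o f) \+ (EFin \o (max_orbit_sum n \o theta)))%E //.
  apply: integrableD => //; apply: integrable_comp_preserving => //.
  exact: measurable_max_orbit_sum.
apply: le_integrable ig => //.
  exact/measurable_EFinP/measurable_max_orbit_sum.
move=> x _; rewrite /= lee_fin -/(g x).
have [g0|g0] := leP 0 (g x); first by rewrite lexx.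
by rewrite normr0.
Qed.

(** Garsia's argument. Where the maximum [M n] is positive it is attained by a
    nonempty sum, which contains the term [f x]; hence [f] is at least
    [M n - M n \o theta] there. Elsewhere that difference is nonpositive, and
    its integral over the whole space vanishes by invariance of [mu]. *)
Lemma maximal_ergodic n :
  (0 <= \int[mu]_(x in [set x | (0 < max_orbit_sum n x)%R]) (f x)%:E)%E.
Proof.
set D := [set x | _].
have mM := measurable_max_orbit_sum n.
have iM := integrable_max_orbit_sum n.
have iMt := integrable_comp_preserving mM iM.
have mD : measurable D.
  rewrite -[D]setTI.
  exact: (measurable_fun_ltr (@measurable_cst _ _ _ _ _ (0 : R)) mM).
have : (\int[mu]_x ((max_orbit_sum n x)%:E -
    (max_orbit_sum n (theta x))%:E) = 0)%E.
  rewrite integralB_EFin//= integral_comp_preserving// subee//.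
  exact: integrable_fin_num.
move=> <-; rewrite [leRHS]integral_mkcond; apply: le_integral => //.
- rewrite (_ : (fun x => _) =
    (EFin \o max_orbit_sum n) \- (EFin \o (max_orbit_sum n \o theta)))%E //.
  exact: integrableB.
- apply/(integrable_mkcond (EFin \o f) mD).
  exact: integrableS intf.
move=> x _; rewrite patchE; case: ifPn => [|]; rewrite ?inE ?notin_setE /D /=.
  case: n {mM iM iMt D mD} => [|n]; first by rewrite ltxx.
  rewrite lt_max ltxx /= => h; rewrite -EFinB lee_fin lerBlDr.
  rewrite (max_idPr (ltW h)) lerD2l; exact: max_orbit_sum_leS.
move=> /negP; rewrite -leNgt => h; rewrite -EFinB lee_fin subr_le0.
exact: le_trans h (max_orbit_sum_ge0 _ _).
Qed.

End maximal_ergodic.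

(** * Path space and upper density of a sequence of events *)

Definition occ (T : Type) (A : nat -> set T) (n : nat) (w : T) : nat :=
  \sum_(i < n) (w \in A i).

Section path_space.
Variable R : realType.

Definition path_space := g_sigma_algebraType
  (\bigcup_i preimage_set_system setT (fun x : nat -> R => x i) measurable).

Definition shift_seq (x : path_space) : path_space := fun j => x j.+1.

Lemma measurable_coordinate (i : nat) :
  measurable_fun setT (fun x : path_space => x i).
Proof.
by move=> _ Y mY; apply: sub_sigma_algebra; exists i => //; exists Y.
Qed.

Lemma measurable_into_path_space d (T : measurableType d)
    (g : T -> path_space) :
  (forall i, measurable_fun setT (fun w => g w i)) -> measurable_fun setT g.
Proof.
move=> mg; apply: (@measurability _ _ T path_space setT g (\bigcup_i
  preimage_set_system setT (fun x : nat -> R => x i) measurable) erefl).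
move=> _ [_ [i _ [Y mY <-]] <-].
rewrite setTI preimage_setI preimage_setT setTI.
by have := mg i measurableT Y mY; rewrite setTI.
Qed.

Lemma measurable_shift_seq : measurable_fun setT shift_seq.
Proof.
by apply: measurable_into_path_space => i; exact: measurable_coordinate.
Qed.

Lemma iter_shift_seq i (x : path_space) :
  iter i shift_seq x = fun j => x (i + j)%N.
Proof.
elim: i => [|i IH] //=; rewrite IH /shift_seq; apply/funext => j.
by rewrite addnS addSn.
Qed.

Lemma measurable_iter_shift_seq i : measurable_fun setT (iter i shift_seq).
Proof.
apply: measurable_into_path_space => j.
rewrite (_ : (fun w => _) = fun x : path_space => x (i + j)%N).
  exact: measurable_coordinate.
by apply/funext => x; rewrite iter_shift_seq.
Qed.

End path_space.

Lemma measurable_occ d (T : measurableType d) (R : realType)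
    (A : nat -> set T) n :
  (forall i, measurable (A i)) ->
  measurable_fun setT (fun w => (occ A n w)%:R : R).
Proof.
move=> mA; rewrite (_ : (fun w => _) = fun w => \sum_(i < n) \1_(A i) w).
  by apply: measurable_sum => i; exact: measurable_indic.
by apply/funext => w; rewrite natr_sum.
Qed.

Section frequency.
Context (T : Type) (R : realType).
Implicit Types (A : nat -> set T) (b : R).

(** The event that the limsup of [occ A n w / n] exceeds [b]. The margin
    [j.+1%:R^-1] is what makes it insensitive to dropping the first event,
    which changes the counts by at most one. *)
Definition upper_density_gt A b : set T :=
  [set w | exists j : nat, forall m : nat, exists2 n : nat, (m <= n)%N &
     (b + j.+1%:R^-1) * n%:R < (occ A n w)%:R].

Lemma upper_density_gt_tail A b :
  upper_density_gt (fun i => A i.+1) b = upper_density_gt A b.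
Proof.
have occS w n : (occ A n.+1 w = (w \in A 0) + occ (fun i => A i.+1) n w)%N.
  by rewrite /occ big_ord_recl.
have half (j : nat) : (j.*2.+1).+1%:R^-1 = j.+1%:R^-1 / 2 :> R.
  by rewrite -doubleS -muln2 natrM invfM.
have large (j n : nat) : (Num.truncn (2 * (`|b| + 2) * j.+1%:R : R) < n)%N ->
    2 * (`|b| + 2) <= j.+1%:R^-1 * n%:R :> R.
  move=> h; rewrite [leRHS]mulrC ler_pdivlMr//.
  apply/ltW/(lt_le_trans (truncnS_gt _)).
  by rewrite ler_nat.
(* The margin is halved, which leaves room for a shift by one once [n] is
   large with respect to [2 * (`|b| + 2) * j.+1]. *)
apply/seteqP; split => w [j h]; exists j.*2.+1 => m; rewrite half.
  have [n mn nh] := h (maxn m (Num.truncn (2 * (`|b| + 2) * j.+1%:R : R)).+1).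
  move: mn; rewrite geq_max => /andP[mn /large nl].
  exists n.+1; first exact: ltnW.
  apply: lt_le_trans (_ : (occ (fun i => A i.+1) n w)%:R <= _); last first.
    by rewrite ler_nat occS leq_addl.
  apply: le_lt_trans nh; rewrite -[n.+1%:R]natr1.
  have e1 : j.+1%:R^-1 <= 1 :> R by rewrite invf_le1// ler1n.
  move: (j.+1%:R^-1) (n%:R) e1 nl (ler_norm b) => e y. lra.
have [n mn nh] := h (maxn m.+1 (Num.truncn (2 * (`|b| + 2) * j.+1%:R : R)).+2).
move: mn nh; rewrite geq_max; case: n => // n /andP[mn /large nl] nh.
exists n => //.
have occ1 : (occ A n.+1 w)%:R <= 1 + (occ (fun i => A i.+1) n w)%:R :> R.
  by rewrite occS natrD lerD2r lern1 leq_b1.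
have e0 : 0 < j.+1%:R^-1 :> R by rewrite invr_gt0.
have nb := ler_norm (- b); rewrite normrN in nb.
move: nh occ1; rewrite -[n.+1%:R]natr1.
move: (j.+1%:R^-1) (n%:R) e0 nl nb (occ A n.+1 w)%:R => e y e0 nl nb x.
move: (_%:R) => z; lra.
Qed.

Lemma upper_density_gt_exists A b w : upper_density_gt A b w ->
  exists n, b * n%:R < (occ A n w)%:R.
Proof.
move=> [j /(_ 0)[n _ h]]; exists n; apply: le_lt_trans h.
by rewrite ler_wpM2r// lerDl.
Qed.

Lemma upper_density_le_near A b w : ~ upper_density_gt A b w ->
  forall e, 0 < e -> \forall n \near \oo, (occ A n w)%:R <= (b + e) * n%:R.
Proof.
move=> nA e e0.
apply: contrapT => h; apply: nA; exists (Num.truncn e^-1) => m.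
apply: contrapT => h'; apply: h; exists m => // n /= mn.
rewrite leNgt; apply/negP => h; apply: h'; exists n => //; apply: le_lt_trans h.
rewrite ler_wpM2r// lerD2l.
rewrite invf_ple ?posrE//. apply: ltW; exact: truncnS_gt.
Qed.

End frequency.

(** * Stationary sequences of events *)

Section stationary_events.
Context d (T : measurableType d) (R : realType) (P : probability T R).
Variable X : nat -> {RV P >-> R}.

(** Sequences of events obtained from one Borel set of paths by looking at the
    process from time [i] on. They replace the iterated preimages of an event
    under a shift of the sample space, which need not exist here; the constant
    ones are the invariant events, so the closure properties below also serve
    for the invariant sigma-field. *)
Definition stationary_events (A : nat -> set T) : Prop :=
  exists2 C : set (nat -> R),
    borel_seq C & forall i, A i = shifted_path X i @^-1` C.

Let path (i : nat) : T -> path_space R := shifted_path X i.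

Let measurable_path i : measurable_fun setT (path i).
Proof.
apply: measurable_into_path_space => j; exact: measurable_funPT.
Qed.

(* With this instance [distribution P (path 0)] is the law of the process. *)
HB.instance Definition _ i :=
  isMeasurableFun.Build _ _ _ _ (path i) (measurable_path i).

Let iter_shift_path i w : iter i (@shift_seq R) (path 0 w) = path i w.
Proof. by rewrite iter_shift_seq. Qed.

Lemma stationary_eventsC A :
  stationary_events A -> stationary_events (fun i => ~` A i).
Proof.
move=> [C mC eqA]; exists (~` C) => [|i]; last by rewrite eqA.
exact: (@measurableC _ (path_space R)).
Qed.

Lemma stationary_events_bigcup (A : nat -> nat -> set T) :
  (forall q, stationary_events (A q)) ->
  stationary_events (fun i => \bigcup_q A q i).
Proof.
move=> /(_ _)/cid2 sA; pose C q := s2val (sA q).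
have mC q : borel_seq (C q) by exact: s2valP (sA q).
have eqA q i : A q i = shifted_path X i @^-1` C q by exact: s2valP' (sA q) i.
exists (\bigcup_q C q) => [|i].
  exact: (@bigcupT_measurable _ (path_space R)).
by rewrite preimage_bigcup; apply: eq_bigcupr => q _; exact: eqA.
Qed.

Lemma stationary_events_bigcap (A : nat -> nat -> set T) :
  (forall q, stationary_events (A q)) ->
  stationary_events (fun i => \bigcap_q A q i).
Proof.
move=> sA; rewrite (_ : (fun i => _) = fun i => ~` \bigcup_q ~` A q i).
  apply/stationary_eventsC/stationary_events_bigcup => q.
  exact: stationary_eventsC.
apply/funext => i; rewrite setC_bigcup; apply: eq_bigcapr => q _.
by rewrite setCK.
Qed.

Lemma stationary_eventsI A B : stationary_events A -> stationary_events B ->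
  stationary_events (fun i => A i `&` B i).
Proof.
move=> [C mC eqA] [D mD eqB]; exists (C `&` D) => [|i].
  exact: (@measurableI _ (path_space R)).
by rewrite eqA eqB.
Qed.

Lemma stationary_eventsU A B : stationary_events A -> stationary_events B ->
  stationary_events (fun i => A i `|` B i).
Proof.
move=> sA sB; rewrite (_ : (fun i => _) = fun i => ~` (~` A i `&` ~` B i)).
  by apply/stationary_eventsC/stationary_eventsI; exact: stationary_eventsC.
by apply/funext => i; rewrite setCI !setCK.
Qed.

Lemma stationary_eventsD A B : stationary_events A -> stationary_events B ->
  stationary_events (fun i => A i `\` B i).
Proof. by move=> sA sB; apply/stationary_eventsI/stationary_eventsC. Qed.

Lemma stationary_events_preimage (Y : set R) : measurable Y ->
  stationary_events (fun i => X i @^-1` Y).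
Proof.
move=> mY; exists ((fun x => x 0%N) @^-1` Y) => [|i].
  have := @measurable_coordinate R 0 measurableT Y mY.
  by rewrite setTI.
by rewrite /shifted_path/=; apply/funext => w /=; rewrite addn0.
Qed.

Lemma stationary_events_measurable A i :
  stationary_events A -> measurable (A i).
Proof.
move=> [C mC ->]; have := @measurable_path i measurableT C mC.
by rewrite setTI.
Qed.

(** Upper densities only depend on the tail of the sequence, so they define
    invariant events. *)
Lemma stationary_upper_density A (b : R) : stationary_events A ->
  stationary_events (fun=> upper_density_gt A b).
Proof.
move=> [C mC eqA].
pose U i : set (path_space R) := iter i (@shift_seq R) @^-1` C.
have mU i : measurable (U i).
  by have := @measurable_iter_shift_seq R i measurableT C mC; rewrite setTI.
exists (upper_density_gt U b) => [|i].
  rewrite (_ : upper_density_gt U b =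
    \bigcup_j \bigcap_m \bigcup_(n in [set n | (m <= n)%N])
    [set x | (b + j.+1%:R^-1) * n%:R < (occ U n x)%:R]).
    apply: (@bigcupT_measurable _ (path_space R)) => j.
    apply: bigcapT_measurable => m; apply: bigcup_measurable => n _.
    rewrite -[X in measurable X]setTI.
    apply: measurable_fun_ltr => //; exact: measurable_occ.
  apply/seteqP; split => x.
    move=> [j h]; exists j => // m _; have [n mn nh] := h m.
    by exists n.
  move=> [j _ h]; exists j => m; have [n mn nh] := h m I.
  by exists n.
have occU i' w n : occ U n (path i' w) = occ (fun l => A (i' + l)%N) n w.
  apply: eq_bigr => l _; congr (nat_of_bool _).
  rewrite eqA; change ((iter l (@shift_seq R) (path i' w) \in C) =
    (path (i' + l) w \in C)).
  by rewrite -[path i' w]iter_shift_path -iterD addnC iter_shift_path.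
have tail i' :
    upper_density_gt (fun l => A (i' + l)%N) b = upper_density_gt A b.
  elim: i' => // i' <-; rewrite -[RHS]upper_density_gt_tail.
  by congr upper_density_gt; apply/funext => l; rewrite addSnnS.
rewrite -(tail i); apply/seteqP; split => w /= [j h]; exists j => m;
  by have [n mn nh] := h m; exists n => //; move: nh; rewrite occU.
Qed.

(** The form of the ergodic theorem from which all almost sure statements are
    derived: on an invariant event where the upper density exceeds [b], the
    conditional probability of [A 0] is on average at least [b]. This is the
    maximal ergodic inequality on path space, under the law of the process,
    for the function [(\1_C - b) * \1_B'], whose sums over orbits issued from
    [B] are [occ A n - b * n]. *)
Lemma ergodic_density A B (b : R) : strictly_stationary X ->
  stationary_events A -> invariant_sigma_field X B ->
  B `<=` upper_density_gt A b -> (b%:E * P B <= P (B `&` A 0%N))%E.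
Proof.
move=> hX [C mC eqA] IB Bdense; have [B' mB' BB'] := IB.
pose mu := distribution P (path 0).
pose th := @shift_seq R.
(* The product is distributed, so that integrals are differences of measures. *)
pose f (x : path_space R) : R := \1_(B' `&` C) x - b * \1_B' x.
have mB'C : measurable (B' `&` C : set (path_space R)) by exact: measurableI.
have mf : measurable_fun setT f.
  apply: measurable_funB; first exact: measurable_indic.
  by apply: measurable_funM => //; exact: measurable_indic.
have i1 : mu.-integrable setT (EFin \o \1_(B' `&` C)).
  exact: integrable_indic.
have i2 : mu.-integrable setT (EFin \o (fun x => b * \1_B' x)).
  have : mu.-integrable setT (EFin \o \1_B') by exact: integrable_indic.
  exact: integrableZl.
have intf : mu.-integrable setT (EFin \o f).
  rewrite (_ : EFin \o f = (EFin \o \1_(B' `&` C)) \-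
    (EFin \o (fun x => b * \1_B' x)%R))%E //.
  exact: integrableB.
have mth : measurable_fun setT th by exact: measurable_shift_seq.
have th_mu A' : measurable A' -> mu (th @^-1` A') = mu A'.
  by move=> mA'; exact: hX 1%N A' mA'.
pose M := max_orbit_sum th f.
have mM n : measurable_fun setT (M n) by exact: measurable_max_orbit_sum.
pose D n := [set x | 0 < M n x].
have mD n : measurable (D n).
  rewrite -[D n]setTI.
  exact: (measurable_fun_ltr (@measurable_cst _ _ _ _ _ (0 : R)) (mM n)).
(* These events exhaust [B], since orbits issued from [B] have positive sums. *)
pose F n := B `&` path 0 @^-1` D n.
have mB : measurable B by exact: (stationary_events_measurable 0 IB).
have mpre (A' : set (path_space R)) :
    measurable A' -> measurable (path 0 @^-1` A').
  by move=> mA'; have := measurable_path 0 measurableT mA'; rewrite setTI.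
have mF n : measurable (F n) by apply: measurableI => //; exact: mpre.
have FB : \bigcup_n F n = B.
  apply/seteqP; split => [w [n _ []]//|w Bw].
  have [n hn] := upper_density_gt_exists (Bdense w Bw).
  exists n => //; split => //; apply: lt_le_trans (orbit_sum_le_max _ _ _ _).
  rewrite -subr_gt0 in hn; rewrite (lt_le_trans hn)// le_eqVlt; apply/orP; left.
  rewrite /occ natr_sum mulrC mulr_natl -[n in X in _ - X]card_ord -sumr_const.
  rewrite -sumrB; apply/eqP/eq_bigr => i _; rewrite iter_shift_path /f.
  have B'w : B' (path i w) by have := Bw; rewrite {1}(BB' i).
  rewrite indicI /= !indicE (mem_set B'w) mul1r mulr1; congr (_ - b).
  by rewrite eqA.
have FP n : (b%:E * P (F n) <= P (B `&` A 0%N))%E.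
  have := maximal_ergodic mth th_mu mf intf n.
  have iS g : mu.-integrable setT g -> mu.-integrable (D n) g.
    exact: integrableS.
  rewrite -[[set x | _]]/(D n) integralB_EFin//; [|exact: iS|exact: iS].
  rewrite integral_indic//; under eq_integral do rewrite EFinM.
  rewrite integralZl//; last first.
    by apply: iS; exact: integrable_indic.
  rewrite integral_indic// sube_ge0; last first.
    by rewrite fin_numM// fin_num_measure//; exact: measurableI.
  have -> : P (F n) = mu (B' `&` D n) by rewrite /F {1}(BB' 0%N).
  move=> /le_trans; apply; have -> : P (B `&` A 0%N) = mu (B' `&` C).
    by rewrite {1}(BB' 0%N) eqA.
  by rewrite le_measure// ?inE//; exact: measurableI.
rewrite -FB; apply: (@cvge_le _ \oo _ _ (fun n => b%:E * P (F n))%E).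
  by apply: nearW => n; rewrite FB; exact: FP.
apply: cvgeZl => //; apply: nondecreasing_cvg_mu => //.
  by rewrite FB.
apply/nondecreasing_seqP => n; apply/subsetPset => w [Bw Dw]; split => //.
exact: lt_le_trans Dw (max_orbit_sum_leS _ _ _ _).
Qed.

End stationary_events.

(** * Almost sure consequences for frequencies *)

Lemma negligible_ae_not d (T : measurableType d) (R : realType)
    (P : probability T R) (B : set T) :
  P.-negligible B -> {ae P, forall w, ~ B w}.
Proof. by apply: negligibleS => w /contrapT. Qed.

Lemma ae_forall_rat d (T : measurableType d) (R : realType)
    (P : probability T R) (Q : rat -> T -> Prop) :
  (forall q, {ae P, forall w, Q q w}) -> {ae P, forall w, forall q, Q q w}.
Proof.
move=> aeQ.
have : {ae P, forall w, forall n, Q (odflt 0 (unpickle n)) w}.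
  by apply: ae_foralln => n; exact: aeQ.
by apply: filterS => w h q; have := h (pickle q); rewrite pickleK.
Qed.

Lemma probability1_ae d (T : measurableType d) (R : realType)
    (P : probability T R) (A : set T) :
  measurable A -> P A = 1%E <-> {ae P, forall w, A w}.
Proof.
move=> mA; split => [A1|/negligibleP A0].
  apply/negligibleP; first exact: measurableC.
  by rewrite [LHS]probability_setC//= A1 subee.
have CA0 : P (~` A) = 0%E by exact: A0 (measurableC mA).
by rewrite -[A]setCK probability_setC ?CA0 ?sube0//; exact: measurableC.
Qed.

Lemma positive_integral_le0_null d (T : measurableType d) (R : realType)
    (P : probability T R) (B : set T) (f : T -> R) : measurable B ->
  P.-integrable B (EFin \o f) -> (forall w, B w -> 0 < f w) ->
  (\int[P]_(w in B) (f w)%:E <= 0)%E -> P.-negligible B.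
Proof.
move=> mB intf f0 If.
have If0 : (\int[P]_(w in B) `|(f w)%:E| = 0)%E.
  apply/eqP; rewrite eq_le integral_ge0// andbT.
  rewrite (eq_integral (EFin \o f))// => w /set_mem Bw.
  by rewrite /= ger0_norm// ltW// f0.
have := (ae_eq_integral_abs P mB (measurable_int _ intf)).1 If0.
apply: negligibleS => w Bw /= /(_ Bw)[] fw0.
by have := f0 w Bw; rewrite fw0 ltxx.
Qed.

Section ergodic_consequences.
Context d (T : measurableType d) (R : realType) (P : probability T R).
Variable X : nat -> {RV P >-> R}.
Hypothesis hX : strictly_stationary X.
Local Notation inv := (invariant_sigma_field X).

Lemma invariant_measurable B : inv B -> measurable B.
Proof. exact: (stationary_events_measurable 0). Qed.

Lemma stationary_events_prob A i : stationary_events X A -> P (A i) = P (A 0%N).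
Proof. by move=> [C mC eqA]; rewrite !eqA; exact: hX. Qed.

(** If the upper density exceeded a rational [q] while [p < q] on a non-null
    invariant event, [ergodic_density] would contradict the definition of the
    conditional probability on that event. *)
Lemma upper_density_le_cond_prob A p : stationary_events X A ->
  is_cond_prob P inv (A 0%N) p ->
  {ae P, forall w, forall e, 0 < e ->
    \forall n \near \oo, (occ A n w)%:R <= (p w + e) * n%:R}.
Proof.
move=> sA [mp ip Ip].
pose B q := upper_density_gt A (ratr q : R) `&` [set w | p w < ratr q].
have IB q : inv (B q).
  apply: stationary_eventsI; first exact: stationary_upper_density.
  by have := mp _ (measurable_itv `]-oo, ratr q[); rewrite set_itvE.
have nB q : {ae P, forall w, ~ B q w}.
  apply: negligible_ae_not; have mB := invariant_measurable (IB q).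
  have iB : P.-integrable (B q) (EFin \o p) by exact: integrableS ip.
  apply: (@positive_integral_le0_null _ _ _ _ _ (fun w => ratr q - p w)) => //.
  - rewrite (_ : EFin \o _ = (EFin \o cst (ratr q)) \- (EFin \o p))%E//.
    by apply: integrableB => //; exact: finite_measure_integrable_cst.
  - by move=> w [_]/=; rewrite subr_gt0.
  rewrite integralB_EFin//; last exact: finite_measure_integrable_cst.
  rewrite Ip// integral_cst//= sube_le0 setIC.
  by apply: (ergodic_density hX sA (IB q)) => w [].
have := ae_forall_rat nB; apply: filterS => w h e e0.
have /rat_in_itvoo[q] : p w < p w + e / 2 by rewrite ltrDl divr_gt0.
rewrite in_itv/= => /andP[pq qe].
have uq : ~ upper_density_gt A (ratr q : R) w by move=> u; exact: (h q).
have e20 : 0 < e / 2 by rewrite divr_gt0.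
have := upper_density_le_near uq e20; apply: filterS => n /le_trans; apply.
by rewrite ler_wpM2r//; lra.
Qed.

Lemma is_cond_probC A p : measurable A -> is_cond_prob P inv A p ->
  is_cond_prob P inv (~` A) (fun w => 1 - p w).
Proof.
move=> mA [mp ip Ip]; split.
- move=> Y mY; have := mp ((fun x => 1 - x) @^-1` Y); apply.
  rewrite -[X in measurable X]setTI; apply: measurable_funB => //.
- rewrite (_ : EFin \o _ = (EFin \o cst (1 : R)%R) \- (EFin \o p))%E//.
  by apply: integrableB => //; exact: finite_measure_integrable_cst.
move=> B IB; have mB := invariant_measurable IB.
rewrite integralB_EFin//; last exact: integrableS ip.
  2: exact: finite_measure_integrable_cst.
rewrite Ip// integral_cst//= mul1e [in RHS]setIC -setDE measureD// 1?setIC//.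
by rewrite ltey_eq fin_num_measure.
Qed.

(** Birkhoff's theorem for events: the lower bound is the upper bound applied
    to the complements. *)
Lemma ergodic_theorem_events A p : stationary_events X A ->
  is_cond_prob P inv (A 0%N) p ->
  {ae P, forall w, forall e, 0 < e -> \forall n \near \oo,
    (p w - e) * n%:R <= (occ A n w)%:R <= (p w + e) * n%:R}.
Proof.
move=> sA pA; have mA := stationary_events_measurable 0 sA.
have := upper_density_le_cond_prob (stationary_eventsC sA)
  (is_cond_probC mA pA).
apply: filterS2 (upper_density_le_cond_prob sA pA) => w up lo e e0.
near=> n; apply/andP; split; last by near: n; exact: up.
have : (occ A n w + occ (fun i => ~` A i) n w)%N = n.
  rewrite /occ -big_split/= -[RHS](card_ord n) -sum1_card.
  apply: eq_bigr => i _.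
  by rewrite in_setC addnC addn_negb.
move=> /(congr1 (fun k => k%:R : R)); rewrite natrD.
have : (occ (fun i => ~` A i) n w)%:R <= (1 - p w + e) * n%:R.
  by near: n; exact: lo.
lra.
Unshelve. all: by end_near. Qed.

(** Continuity from above for densities: on the invariant event where all the
    upper densities exceed [j.+1%:R^-1], [ergodic_density] bounds the
    probability by [j.+1 * P (A m 0)], which tends to [0]. *)
Lemma vanishing_upper_density (A : nat -> nat -> set T) :
  (forall m, stationary_events X (A m)) ->
  (forall m, A m.+1 0%N `<=` A m 0%N) -> P (\bigcap_m A m 0%N) = 0%E ->
  {ae P, forall w, forall e : R, 0 < e -> exists m,
    \forall n \near \oo, (occ (A m) n w)%:R <= e * n%:R}.
Proof.
move=> sA dA A0.
have mA m := stationary_events_measurable 0 (sA m).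
pose B (j : nat) := \bigcap_m upper_density_gt (A m) (j.+1%:R^-1 : R).
have IB j : inv (B j).
  by apply: stationary_events_bigcap => m; exact: stationary_upper_density.
have PA0 : P (A m 0%N) @[m --> \oo] --> 0%E.
  rewrite -A0; apply: nonincreasing_cvg_mu => //.
  - by rewrite ltey_eq fin_num_measure.
  - exact: bigcapT_measurable.
  - by apply/nonincreasing_seqP => m; apply/subsetPset; exact: dA.
have nB : {ae P, forall w, forall j, ~ B j w}.
  apply: ae_foralln => j; apply: negligible_ae_not.
  have mB := invariant_measurable (IB j).
  apply/negligibleP => //.
  have : ((j.+1%:R^-1)%:E * P (B j) <= 0)%E.
    apply: (cvge_ge _ PA0); apply: nearW => m.
    apply: le_trans (_ : P (B j `&` A m 0%N) <= _)%E; last first.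
      by rewrite le_measure// ?inE//; exact: measurableI.
    by apply: (ergodic_density hX (sA m) (IB j)) => w /(_ m I); exact.
  rewrite pmule_rle0 ?lte_fin ?invr_gt0// measure_le0; by move/eqP.
apply: filterS nB => w nB e e0; pose j := Num.truncn (e / 2)^-1.
have je : j.+1%:R^-1 <= e / 2.
  rewrite invf_ple ?posrE ?divr_gt0//; apply: ltW; exact: truncnS_gt.
have [m um] : exists m, ~ upper_density_gt (A m) (j.+1%:R^-1 : R) w.
  apply: contrapT => h; apply: (nB j) => m _; apply: contrapT => um.
  by apply: h; exists m.
exists m; have e20 : 0 < e / 2 by rewrite divr_gt0.
have := upper_density_le_near um e20; apply: filterS => n /le_trans; apply.
by rewrite ler_wpM2r// [leRHS]splitr lerD2r.
Qed.

Section right_endpoint.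
Variable gamma : T -> \bar R.
Hypothesis hgamma : is_cond_right_endpoint P inv (X 0%N) gamma.

Lemma right_endpoint_invariant (Y : set (\bar R)) : measurable Y ->
  inv (gamma @^-1` Y).
Proof. by have [mg _ _] := hgamma; exact: mg. Qed.

(** Integrating a version equal to [1] gives [P A = 1]; conversely, the constant
    [1] is a version as soon as the complement of [A] is null. *)
Lemma cond_prob_eq1P A : measurable A -> cond_prob_eq1 P inv A <-> P A = 1%E.
Proof.
move=> mA; split => [[p [mp ip Ip] p1]|A1].
  have := Ip setT; rewrite setIT => <-.
    rewrite (ae_eq_integral (cst 1%E))//.
    - by rewrite integral_cst// mul1e; exact: probability_setT.
    - exact: measurable_int ip.
    - by apply: filterS p1 => w /= -> _.
  by exists setT => [|i]; [exact: (@measurableT _ (path_space R))|].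
exists (cst 1); last exact: aeW.
split.
- move=> Y mY; rewrite preimage_cst; case: ifP => _.
    by exists setT => [|i]; [exact: (@measurableT _ (path_space R))|].
  by exists set0 => [|i]; [exact: (@measurable0 _ (path_space R))|].
- exact: finite_measure_integrable_cst.
move=> B IB; have mB := invariant_measurable IB.
have BA0 : P (B `\` A) = 0%E.
  apply/eqP; rewrite -measure_le0.
  have <- : P (~` A) = 0%E by rewrite probability_setC// A1 subee.
  apply: le_measure; rewrite ?inE; [exact: measurableD|exact: measurableC|].
  by move=> w [].
have BA : P B = P (A `&` B).
  by rewrite setIC -[RHS]add0e -BA0; exact: measureDI.
by rewrite (eq_integral (cst 1%E))// integral_cst// mul1e; exact: BA.
Qed.

(** A rational threshold between [gamma - r] and [X i] reduces the event to
    countably many intersections of an invariant event on [gamma] with an event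
    on [X i]. *)
Lemma stationary_events_gt_endpoint (r : R) :
  stationary_events X (fun i => [set w | (gamma w - r%:E < (X i w)%:E)%E]).
Proof.
pose A q i :=
  [set w | (gamma w <= (q + r)%:E)%E] `&` X i @^-1` `]q, +oo[%classic.
have sA q : stationary_events X (A q).
  apply: stationary_eventsI; last exact: stationary_events_preimage.
  by have := right_endpoint_invariant (emeasurable_itv `]-oo, (q + r)%:E]);
    rewrite set_itvE.
have := stationary_events_bigcup (fun n => sA (ratr (odflt 0 (unpickle n)))).
congr stationary_events; apply/funext => i; apply/seteqP; split => w.
  move=> [n _ []]/=; rewrite in_itv/= andbT; set q := ratr _ => gq qX.
  by rewrite EFinN lteBlDr// (le_lt_trans gq)// -EFinD lte_fin ltrD2r.
move=> /= gX.
have [q gq qX] :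
    exists2 q : rat, (gamma w <= (ratr q + r)%:E)%E & ratr q < X i w.
  case: (gamma w) gX => [g| |] gX.
  - have /rat_in_itvoo[q] : g - r < X i w by rewrite -lte_fin.
    rewrite in_itv/= => /andP[gq qX]; exists q => //.
    by rewrite lee_fin -lerBlDr ltW.
  - by [].
  - have /rat_in_itvoo[q] : X i w - 1 < X i w by rewrite ltrBlDr ltrDl.
    by rewrite in_itv/= => /andP[_ qX]; exists q => //; exact: leNye.
by exists (pickle q) => //; rewrite pickleK; split => //=; rewrite in_itv/= qX.
Qed.

Lemma ae_le_endpoint : {ae P, forall w, forall i, ((X i w)%:E <= gamma w)%E}.
Proof.
have sG : stationary_events X (fun i => ~` [set w | (gamma w < (X i w)%:E)%E]).
  apply: stationary_eventsC; have := stationary_events_gt_endpoint 0.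
  congr stationary_events; apply/funext => i; apply/seteqP.
  by split => w /=; rewrite sube0.
apply: ae_foralln => i.
have mG j := stationary_events_measurable j sG.
have /probability1_ae : P (~` [set w | (gamma w < (X i w)%:E)%E]) = 1%E.
  rewrite (stationary_events_prob i sG).
  have [_ + _] := hgamma; rewrite (_ : [set w | _] =
    ~` [set w | (gamma w < (X 0%N w)%:E)%E]).
    by move=> /cond_prob_eq1P; apply.
  by apply/seteqP; split => w /=; [move=> h /lt_geF; rewrite h|
    move=> /negP; rewrite -leNgt].
move=> /(_ (mG i)); apply: filterS => w /= /negP.
by rewrite -leNgt.
Qed.

(** This is where minimality of the right endpoint enters. Let [B] be the
    invariant event where [c < gamma] and the values [<= c] have upper density
    one. By [ergodic_density], [X 0 <= c] almost surely on [B], so lowering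
    [gamma] to [c] on [B] still bounds [X 0] from above; minimality then forces
    [B] to be null. *)
Lemma below_endpoint_density : {ae P, forall w, forall c : rat,
  ((ratr c)%:E < gamma w)%E -> exists2 e : R, 0 < e &
  \forall n \near \oo,
    (occ (fun i => [set v | X i v <= ratr c]) n w)%:R <= (1 - e) * n%:R}.
Proof.
apply: ae_forall_rat => q; pose c : R := ratr q.
pose A i := [set v | X i v <= c].
have sA : stationary_events X A.
  by have := stationary_events_preimage X (measurable_itv `]-oo, c]);
    rewrite set_itvE.
pose B := [set w | (c%:E < gamma w)%E] `&`
  \bigcap_j upper_density_gt A (1 - j.+1%:R^-1 : R).
have IB : inv B.
  apply: stationary_eventsI.
    by have := right_endpoint_invariant (emeasurable_itv `]c%:E, +oo[);
      rewrite set_itvE.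
  by apply: stationary_events_bigcap => j; exact: stationary_upper_density.
have mA := stationary_events_measurable 0 sA.
have mB := invariant_measurable IB.
have mBA : measurable (B `\` A 0%N) by exact: measurableD.
(* To be applied to the probabilities of [B], [B `\` A 0] and [B `&` A 0]. *)
have gap0 (r s t : R) : (forall j : nat, (1 - j.+1%:R^-1) * r <= t) ->
    r <= 1 -> 0 <= s -> r = s + t -> s = 0.
  move=> dense r1 s0 rE; apply/eqP; rewrite eq_le s0 andbT leNgt.
  apply/negP => s1; have := dense (Num.truncn s^-1).
  have : (Num.truncn s^-1).+1%:R^-1 < s.
    by rewrite invf_plt ?posrE//; exact: truncnS_gt.
  have : 0 < (Num.truncn s^-1).+1%:R^-1 :> R by rewrite invr_gt0.
  move: (_.+1%:R^-1) => y; nra.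
have PBA : P (B `\` A 0%N) = 0%E.
  have dense j : ((1 - j.+1%:R^-1)%:E * P B <= P (B `&` A 0%N))%E.
    by apply: (ergodic_density hX sA IB) => w [_ /(_ j I)].
  have fin D : measurable D -> P D = (fine (P D))%:E.
    by move=> mD; rewrite fineK// fin_num_measure.
  have mBiA : measurable (B `&` A 0%N) by exact: measurableI.
  have B1 : (P B <= 1)%E by exact: probability_le1.
  have BA_ge0 : (0 <= P (B `\` A 0%N))%E by [].
  have BE : P B = (P (B `\` A 0%N) + P (B `&` A 0%N))%E by exact: measureDI.
  move: dense B1 BA_ge0 BE; rewrite (fin _ mB) (fin _ mBA) (fin _ mBiA).
  rewrite -EFinD !lee_fin => dense B1 s0 []rE; congr (_%:E).
  by apply: gap0 B1 s0 rE => j; have := dense j; rewrite -EFinM lee_fin.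
pose gamma' w := if w \in B then c%:E else gamma w.
have g'B w : B w -> gamma' w = c%:E by move=> Bw; rewrite /gamma' mem_set.
have g'NB w : ~ B w -> gamma' w = gamma w by move=> Bw; rewrite /gamma' memNset.
have mg' : measurable_wrt inv gamma'.
  move=> Y mY; rewrite (_ : gamma' @^-1` Y =
    (B `&` [set _ | Y c%:E]) `|` (~` B `&` gamma @^-1` Y)); last first.
    apply/seteqP; split => w /=.
      have [Bw|Bw] := pselect (B w); first by rewrite g'B//; left.
      by rewrite g'NB//; right.
    by move=> [[Bw]|[Bw]]; [rewrite g'B|rewrite g'NB].
  apply: stationary_eventsU; apply: stationary_eventsI => //.
  - have [cY|cY] := pselect (Y c%:E).
      exists setT => [|i]; first exact: (@measurableT _ (path_space R)).
      by apply/seteqP; split.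
    exists set0 => [|i]; first exact: (@measurable0 _ (path_space R)).
    by apply/seteqP; split.
  - exact: stationary_eventsC.
  - exact: right_endpoint_invariant.
have mG0 := stationary_events_measurable 0 (stationary_events_gt_endpoint 0).
have [_ _ gmin] := hgamma.
have /gmin-/(_ mg') :
    cond_prob_eq1 P inv [set w | ((X 0%N w)%:E <= gamma' w)%E].
  have mg'' : measurable [set w | ((X 0%N w)%:E <= gamma' w)%E].
    rewrite (_ : [set w | _] = (B `&` A 0%N) `|`
      (~` B `\` [set w | (gamma w - 0%:E < (X 0%N w)%:E)%E])).
      apply: measurableU; first exact: measurableI.
      by apply: measurableD => //; exact: measurableC.
    apply/seteqP; split => w /=; rewrite sube0.
      have [Bw|Bw] := pselect (B w); first by rewrite g'B//; left.
      by rewrite g'NB//; right; split => //; rewrite ltNge; exact/negP/negPn.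
    move=> [[Bw]|[Bw]]; first by rewrite g'B.
    by rewrite g'NB// ltNge => /negP/negPn.
  apply/cond_prob_eq1P => //; apply/probability1_ae => //.
  have nBA : {ae P, forall w, ~ (B `\` A 0%N) w}.
    by apply: negligible_ae_not; exact/negligibleP.
  apply: filterS2 ae_le_endpoint nBA => w /(_ 0%N) Xg nBA /=.
  have [Bw|Bw] := pselect (B w); last by rewrite g'NB.
  by rewrite g'B// lee_fin; apply: contrapT => Xc; exact: nBA.
apply: filterS => w gg' cg.
have nBw : ~ B w.
  by move=> Bw; move: gg'; rewrite g'B// leNgt cg.
have [j uj] : exists j, ~ upper_density_gt A (1 - j.+1%:R^-1 : R) w.
  apply: contrapT => h; apply: nBw; split => // j _; apply: contrapT => uj.
  by apply: h; exists j.
have e20 : 0 < j.+1%:R^-1 / 2 :> R by rewrite divr_gt0// invr_gt0.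
exists (j.+1%:R^-1 / 2) => //; have := upper_density_le_near uj e20.
apply: filterS => n /le_trans; apply.
rewrite ler_wpM2r//; move: (_.+1%:R^-1) => y; lra.
Qed.

End right_endpoint.
End ergodic_consequences.

(** * Order statistics *)

Section order_statistics.
Variable R : realType.
Implicit Types (x : nat -> R) (n k : nat) (c : R).

Let sorted_sample x n : sorted <=%R (sort <=%R (mkseq x n)).
Proof. exact/sort_sorted/le_total. Qed.

Lemma count_sorted_sample x n c :
  count (<= c) (sort <=%R (mkseq x n)) = (\sum_(i < n) (x i <= c)%R)%N.
Proof.
rewrite count_sort count_map -sum1_count big_mkcond/=.
rewrite -(big_mkord xpredT (fun i => (x i <= c)%R : nat)).
by rewrite /index_iota subn0; apply: eq_bigr => i _ /=; case: (x i <= c).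
Qed.

Lemma order_stat_gt x n k c : (1 <= k <= n)%N ->
  (c < order_stat x n k) = (\sum_(i < n) (x i <= c)%R < k)%N.
Proof.
case: k => // k /= kn; rewrite -(count_sorted_sample x n c) ltnS.
apply/idP/idP => [|h].
  apply: contraTT; rewrite -ltnNge -leNgt; exact: nth_count_le.
apply: nth_count_gt; first exact: sorted_sample.
by rewrite h size_sort size_mkseq.
Qed.

Lemma order_stat_mem x n k : (1 <= k <= n)%N ->
  exists2 i, (i < n)%N & order_stat x n k = x i.
Proof.
case: k => // k /= kn.
have : order_stat x n k.+1 \in sort <=%R (mkseq x n).
  by rewrite mem_nth// size_sort size_mkseq.
rewrite mem_sort => /mapP[i]; rewrite mem_iota add0n => /andP[_ ik] ->.
by exists i.
Qed.

Lemma measurable_order_stat d (T : measurableType d) (X : nat -> T -> R) n k :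
  (1 <= k <= n)%N -> (forall i, measurable_fun setT (X i)) ->
  measurable_fun setT (fun w => order_stat (X ^~ w) n k).
Proof.
move=> kn mX; apply: (measurability _ (RGenOInfty.measurableE R)).
move=> _ [_ [c ->] <-]; rewrite setTI.
have mA i : measurable [set w | X i w <= c].
  rewrite -[X in measurable X]setTI.
  exact: measurable_fun_ler (mX i) (@measurable_cst _ _ _ _ _ c) _ _ _.
rewrite (_ : _ @^-1` _ =
  [set w | (occ (fun i => [set v | X i v <= c]) n w)%:R < k%:R :> R]).
  rewrite -[X in measurable X]setTI; apply: measurable_fun_ltr => //.
  exact: measurable_occ.
have occE w : occ (fun i => [set v | X i v <= c]) n w =
    (\sum_(i < n) (X i w <= c)%R)%N.
  by apply: eq_bigr => i _; rewrite mem_setE.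
by apply/seteqP; split => w /=;
  rewrite in_itv/= andbT order_stat_gt// ltr_nat occE.
Qed.

Lemma measurable_near_order_stat_count d (T : measurableType d) (a : R)
    (X : nat -> T -> R) n k :
  (1 <= n -> 1 <= k <= n)%N -> (forall i, measurable_fun setT (X i)) ->
  measurable_fun setT
    (fun w => (near_order_stat_count a (X ^~ w) n k)%:R : R).
Proof.
case: n => [|n] kn mX.
  rewrite (_ : (fun w => _) = cst 0)//.
  by apply/funext => w; rewrite /near_order_stat_count big_ord0.
have mO := measurable_order_stat (kn erefl) mX.
rewrite (_ : (fun w => _) = fun w => (occ (fun i => [set v |
    order_stat (X ^~ v) n.+1 k - a < X i v] `&`
    [set v | X i v < order_stat (X ^~ v) n.+1 k]) n.+1 w)%:R).
  apply: measurable_occ => i.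
  apply: measurableI; rewrite -[X in measurable X]setTI.
    by apply: measurable_fun_ltr => //; exact: measurable_funB.
  exact: measurable_fun_ltr.
apply/funext => w; congr (_%:R); apply: eq_bigr => i _.
by rewrite in_setI !mem_setE.
Qed.

End order_statistics.

Lemma occ_le (T : Type) (A B : nat -> set T) n w :
  (forall i, A i w -> B i w) -> (occ A n w <= occ B n w)%N.
Proof.
move=> AB; apply: leq_sum => i _; have [Aw|] := boolP (w \in A i) => //.
by rewrite mem_set//; apply/AB/set_mem.
Qed.

Lemma occ_le_add (T : Type) (A B C : nat -> set T) n w :
  (forall i, A i w -> B i w \/ C i w) ->
  (occ A n w <= occ B n w + occ C n w)%N.
Proof.
move=> AB; rewrite -big_split; apply: leq_sum => i _ /=.
have [/set_mem/AB[]|_] := boolP (w \in A i); last by [].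
  by move=> /mem_set ->.
by move=> /mem_set ->; rewrite addnC.
Qed.

(** * Almost sure limit along the deterministic sample sizes *)

Lemma ae_not_measure0 d (T : measurableType d) (R : realType)
    (P : probability T R) (B : set T) :
  measurable B -> {ae P, forall w, ~ B w} -> P B = 0%E.
Proof.
by move=> mB nB; apply/negligibleP => //; apply: negligibleS nB => w Bw; exact.
Qed.

Lemma le_of_lt_add_invS (R : realType) (x y : R) :
  (forall m : nat, y - m.+1%:R^-1 < x) -> y <= x.
Proof.
move=> yx; rewrite leNgt; apply/negP; rewrite -subr_gt0 => xy.
have := yx (Num.truncn (y - x)^-1); rewrite ltrBlDr -ltrBlDl; apply/negP.
by rewrite -leNgt invf_ple ?posrE//; apply: ltW; exact: truncnS_gt.
Qed.

Section near_order_statistic.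
Context d (T : measurableType d) (R : realType) (P : probability T R).
Variables (X : nat -> {RV P >-> R}) (hX : strictly_stationary X).
Variables (gamma : T -> \bar R)
  (hgamma : is_cond_right_endpoint P (invariant_sigma_field X) (X 0%N) gamma).
Variables (k : nat -> nat)
  (hk : forall n : nat, (1 <= n)%N -> (1 <= k n <= n)%N)
  (hk1 : ((k n)%:R / n%:R : R) @[n --> \oo] --> (1 : R)).

Let order_seq n w : R := order_stat (X ^~ w) n (k n).

(** The values [<= c] eventually make up less than a fraction [1 - e] of the
    sample, while the rank [k n] is eventually more than [(1 - e) * n]. *)
Lemma order_stat_eventually_gt : {ae P, forall w, forall c : R,
  (c%:E < gamma w)%E -> \forall n \near \oo, c < order_seq n w}.
Proof.
apply: filterS (below_endpoint_density hX hgamma) => w dens c cg.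
have [q cq qg] : exists2 q : rat, c < ratr q & ((ratr q)%:E < gamma w)%E.
  case: (gamma w) cg => [g| |]//.
    rewrite lte_fin => /rat_in_itvoo[q]; rewrite in_itv/= => /andP[cq qg].
    by exists q.
  move=> _; have /rat_in_itvoo[q] : c < c + 1 by rewrite ltrDl.
  by rewrite in_itv/= => /andP[cq _]; exists q => //; rewrite ltry.
have [e e0 occ_e] := dens q qg.
have ke : \forall n \near \oo, 1 - e < (k n)%:R / n%:R.
  by apply: (cvgr_gt 1) => //; rewrite ltrBlDr ltrDl.
near=> n; apply: lt_trans cq _.
have n0 : (0 < n)%N by near: n; exact: nbhs_infty_gt.
rewrite /order_seq order_stat_gt; last exact: hk.
rewrite -(ltr_nat R); apply: (@le_lt_trans _ _ ((1 - e) * n%:R)).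
  have -> : (\sum_(i < n) (X i w <= ratr q)%R)%N =
      occ (fun i => [set v | X i v <= ratr q]) n w.
    by apply: eq_bigr => i _; rewrite mem_setE.
  by near: n; exact: occ_e.
by rewrite -ltr_pdivlMr ?ltr0n//; near: n; exact: ke.
Unshelve. all: by end_near. Qed.

Variable a : R.
Hypotheses (hP0 : P [set w | (X 0%N w)%:E = gamma w] = 0%E)
  (hPa : P [set w | (X 0%N w)%:E = (gamma w - a%:E)%E] = 0%E).

Let bounded (i : nat) : set T := [set w | (gamma w < +oo)%E].
Let above (r : R) (i : nat) : set T :=
  [set w | (gamma w - r%:E < (X i w)%:E)%E].

Let stationary_bounded : stationary_events X bounded.
Proof.
by have := right_endpoint_invariant hgamma
  (emeasurable_itv `]-oo, (+oo%E : \bar R)[);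
  rewrite set_itvE.
Qed.

Let stationary_above r : stationary_events X (above r).
Proof. exact: stationary_events_gt_endpoint. Qed.

Let gamma_measurable : measurable_fun setT gamma.
Proof.
move=> _ Y mY; rewrite setTI.
exact: (invariant_measurable (right_endpoint_invariant hgamma mY)).
Qed.

(** Together with [few_near_endpoint_sub], bounds the frequency of the values by
    which the window of the order statistic differs from the window below
    [gamma]. The events decrease to [X 0 = gamma], up to the null event where
    [X 0] exceeds [gamma]. *)
Lemma few_near_endpoint : {ae P, forall w, forall e : R, 0 < e ->
  exists m, \forall n \near \oo,
   (occ (fun i => bounded i `&` above m.+1%:R^-1 i) n w)%:R <= e * n%:R}.
Proof.
apply: (vanishing_upper_density hX
  (A := fun m i => bounded i `&` above m.+1%:R^-1 i)).
- by move=> m; exact: stationary_eventsI.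
- move=> m w [bw gw]; split => //; apply: le_lt_trans gw.
  by rewrite leeB// lee_fin lef_pV2 ?posrE// ler_nat.
apply: ae_not_measure0; first by apply: bigcapT_measurable => m;
  exact: (stationary_events_measurable 0 (stationary_eventsI stationary_bounded
    (stationary_above _))).
have mE : measurable [set w | (X 0%N w)%:E = gamma w].
  rewrite -[X in measurable X]setTI; apply: measurable_eqe => //.
  exact/measurable_EFinP.
have /negligible_ae_not := (negligibleP P mE).2 hP0.
apply: filterS2 (ae_le_endpoint hX hgamma) => w /(_ 0%N) Xg Xneg S.
have {}S m : bounded 0%N w /\ above m.+1%:R^-1 0%N w by exact: (S m I).
apply: Xneg => /=; move: Xg S; rewrite /bounded /above/=.
case: (gamma w) => [g| |] Xg S; last 2 first.
- by have [] := S 0%N.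
- by [].
apply/eqP; rewrite eq_le Xg/= lee_fin; apply: le_of_lt_add_invS => m.
by have [_] := S m; rewrite -EFinB lte_fin.
Qed.

(** The events decrease to [X 0 = gamma - a] where [gamma] is finite. *)
Lemma few_near_endpoint_sub : {ae P, forall w, forall e : R, 0 < e ->
  exists m, \forall n \near \oo,
   (occ (fun i => bounded i `&` (above (a + m.+1%:R^-1) i `\` above a i)) n w)%:R
   <= e * n%:R}.
Proof.
have sA m : stationary_events X (fun i => bounded i `&`
    (above (a + m.+1%:R^-1) i `\` above a i)).
  by apply: stationary_eventsI => //; exact: stationary_eventsD.
apply: (vanishing_upper_density hX (A := fun m i => bounded i `&`
  (above (a + m.+1%:R^-1) i `\` above a i))) => //.
- move=> m w [bw [gw nw]]; split => //; split => //; apply: le_lt_trans gw.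
  by rewrite leeB// lee_fin lerD2l lef_pV2 ?posrE// ler_nat.
apply: ae_not_measure0; first by apply: bigcapT_measurable => m;
  exact: (stationary_events_measurable 0 (sA m)).
have mE : measurable [set w | (X 0%N w)%:E = (gamma w - a%:E)%E].
  rewrite -[X in measurable X]setTI; apply: measurable_eqe => //.
    exact/measurable_EFinP.
  by apply: emeasurable_funB.
have /negligible_ae_not := (negligibleP P mE).2 hPa.
apply: filterS2 (ae_le_endpoint hX hgamma) => w /(_ 0%N) Xg Xneg S.
have {}S m : [/\ bounded 0%N w, above (a + m.+1%:R^-1) 0%N w & ~ above a 0%N w].
  by have [? []] := S m I.
apply: Xneg => /=; move: Xg S; rewrite /bounded /above/=.
case: (gamma w) => [g| |] Xg S; last 2 first.
- by have [] := S 0%N.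
- by [].
apply/eqP; rewrite -EFinB eq_le !lee_fin; apply/andP; split.
  by have [_ _ /negP] := S 0%N; rewrite -leNgt -EFinB lee_fin.
apply: le_of_lt_add_invS => m.
by have [_ + _] := S m; rewrite -EFinB lte_fin opprD addrA.
Qed.

Lemma few_large : {ae P, forall w, forall e : R, 0 < e ->
  exists m : nat, \forall n \near \oo,
   (occ (fun i => X i @^-1` `]m%:R, +oo[%classic) n w)%:R <= e * n%:R}.
Proof.
apply: (vanishing_upper_density hX
  (A := fun (m : nat) i => X i @^-1` `]m%:R, +oo[%classic)).
- by move=> m; exact: stationary_events_preimage.
- move=> m w /=; rewrite !in_itv/= !andbT; apply: le_lt_trans.
  by rewrite ler_nat.
rewrite (_ : \bigcap_m _ = set0) ?measure0//; apply/seteqP; split => // w h.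
have /= := h (Num.truncn (X 0%N w)).+1 I; rewrite in_itv/= andbT => /lt_trans.
by move=> /(_ _ (truncnS_gt _)); rewrite ltxx.
Qed.

Variable p : T -> R.
Hypothesis hp : is_cond_prob P (invariant_sigma_field X)
  [set w | (gamma w - a%:E < (X 0%N w)%:E)%E] p.

Lemma near_order_stat_count_occ n w :
  near_order_stat_count a (X ^~ w) n (k n) = occ (fun i =>
    [set v | order_seq n w - a < X i v < order_seq n w]) n w.
Proof. by apply: eq_bigr => i _; rewrite mem_setE. Qed.

(** When [gamma] is finite, the order statistic lies in a small interval below
    [gamma], so the window differs from [gamma - a < X i] only by values just
    below [gamma] or just below [gamma - a]. When [gamma] is infinite, the
    window is eventually above any level. *)
Lemma near_order_stat_ratio_cvg : {ae P, forall w,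
  ((near_order_stat_count a (X ^~ w) n (k n))%:R / n%:R : R) @[n --> \oo] -->
  \1_[set v | (gamma v < +oo)%E] w * p w}.
Proof.
have limits := @filterI _ _ (ae_filter_ringOfSetsType P) _ _
  few_large (ergodic_theorem_events hX (stationary_above a) hp).
have few := @filterI _ _ (ae_filter_ringOfSetsType P) _ _
  few_near_endpoint few_near_endpoint_sub.
have position := @filterI _ _ (ae_filter_ringOfSetsType P) _ _
  (ae_le_endpoint hX hgamma) order_stat_eventually_gt.
apply: (@filterS3 _ _ (ae_filter_ringOfSetsType P) _ _ _ _ _ limits few position)
  => w [large freq] [few1 few2] [Xg gtM].
pose K n := fun i => [set v | order_seq n w - a < X i v < order_seq n w].
have leM n : (0 < n)%N -> ((order_seq n w)%:E <= gamma w)%E.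
  by move=> /hk/(order_stat_mem (X ^~ w))[i _]; rewrite /order_seq => ->.
apply/cvgrPdist_le => e e0.
have ratio n (r : R) : (0 < n)%N ->
    `|r * n%:R - (occ (K n) n w)%:R| <= e * n%:R ->
    `|r - (near_order_stat_count a (X ^~ w) n (k n))%:R / n%:R| <= e.
  move=> n0 h; have nR : 0 < n%:R :> R by rewrite ltr0n.
  rewrite near_order_stat_count_occ -(ler_pM2r nR) -{2}[n%:R](gtr0_norm nR).
  by rewrite -normrM mulrBl divfK ?gt_eqF.
have e2 : 0 < e / 2 by rewrite divr_gt0.
have [gy|gy] := eqVneq (gamma w) +oo%E.
  have [m few_m] := large e e0.
  have gtMm := gtM (m%:R + a); rewrite gy ltry in gtMm.
  have {}gtMm := gtMm erefl.
  rewrite indicE memNset ?mul0r; last by rewrite /= gy ltxx.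
  near=> n; have n0 : (0 < n)%N by near: n; exact: nbhs_infty_gt.
  apply: ratio => //; rewrite mul0r sub0r normrN ger0_norm//.
  apply: le_trans
    (_ : _ <= (occ (fun i => X i @^-1` `]m%:R, +oo[%classic) n w)%:R) _;
    last by near: n; exact: few_m.
  rewrite ler_nat; apply: occ_le => i /= /andP[h _]; rewrite in_itv/= andbT.
  apply: lt_trans h; rewrite ltrBrDr.
  by near: n; exact: gtMm.
have within (y q K0 A B1 B2 : R) : (q - e / 2) * y <= A ->
    A <= (q + e / 2) * y -> B1 <= e / 2 * y -> B2 <= e / 2 * y ->
    A <= K0 + B1 -> K0 <= A + B2 -> `|q * y - K0| <= e * y.
  by move=> *; rewrite ler_norml; apply/andP; split; lra.
have bw : (gamma w < +oo)%E by rewrite ltey.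
rewrite indicE mem_set ?mul1r//.
have [g gE] : exists g, gamma w = g%:E.
  case: (gamma w) gy (Xg 0%N) => [g| |]// _ _; by exists g.
have below (m : nat) : \forall n \near \oo, g - m.+1%:R^-1 < order_seq n w.
  by apply: gtM; rewrite gE lte_fin ltrBlDr ltrDl invr_gt0.
have [m1 few_m1] := few1 _ e2.
have [m2 few_m2] := few2 _ e2.
have freq_e := freq _ e2.
near=> n; have n0 : (0 < n)%N by near: n; exact: nbhs_infty_gt.
apply: ratio => //.
have Mg : order_seq n w <= g by have := leM n n0; rewrite gE lee_fin.
have gM1 : g - m1.+1%:R^-1 < order_seq n w by near: n; exact: below.
have gM2 : g - m2.+1%:R^-1 < order_seq n w by near: n; exact: below.
have lower : (occ (above a) n w <= occ (K n) n w +
    occ (fun i => bounded i `&` above m1.+1%:R^-1 i) n w)%N.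
  apply: occ_le_add => i; rewrite /above/= gE -!EFinB !lte_fin => gX.
  have [XM|MX] := ltP (X i w) (order_seq n w); [left|right].
    by rewrite /K/= XM andbT; apply: le_lt_trans gX; rewrite lerD2r.
  by split => //; exact: lt_le_trans MX.
have upper : (occ (K n) n w <= occ (above a) n w +
    occ (fun i => bounded i `&` (above (a + m2.+1%:R^-1) i `\` above a i)) n w)%N.
  apply: occ_le_add => i; rewrite /above/= gE -!EFinB !lte_fin => /andP[MX _].
  have [gX|Xg'] := ltP (g - a) (X i w); [by left|right].
  split => //; split => //; apply: le_lt_trans MX.
  by move: (m2.+1%:R^-1) gM2 => y; lra.
have /andP[freq1 freq2] : (p w - e / 2) * n%:R <= (occ (above a) n w)%:R
    <= (p w + e / 2) * n%:R by near: n; exact: freq_e.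
have o1 : (occ (fun i => bounded i `&` above m1.+1%:R^-1 i) n w)%:R
  <= e / 2 * n%:R by near: n; exact: few_m1.
have o2 : (occ (fun i => bounded i `&` (above (a + m2.+1%:R^-1) i `\` above a i))
  n w)%:R <= e / 2 * n%:R by near: n; exact: few_m2.
rewrite -!(ler_nat R) !natrD in lower upper.
exact: within freq1 freq2 o1 o2 lower upper.
Unshelve. all: by end_near. Qed.

End near_order_statistic.

(** * Random sample sizes *)

Section random_index.
Context d (T : measurableType d) (R : realType) (P : probability T R).
Variables (Y : nat -> T -> R) (L : T -> R) (N : R -> T -> nat).
Hypothesis YL : {ae P, forall w, Y n w @[n --> \oo] --> L w}.

Lemma cvg_as_random_index :
  diverges_as P N -> cvg_as P (fun t w => Y (N t w) w) L.
Proof.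
move=> Noo; apply: filterS2 YL Noo => w YLw Nw.
exact: (cvg_comp _ _ Nw YLw).
Qed.

Hypotheses (mY : forall n, measurable_fun setT (Y n))
  (mL : measurable_fun setT L)
  (mN : forall t, 0 <= t -> measurable_fun setT (N t)).

(** Outside [N t <= m] the deviation at the index [N t] is among the deviations
    at indices beyond [m], whose union has small probability by almost sure
    convergence. *)
Lemma cvg_in_prob_random_index :
  diverges_in_prob P N -> cvg_in_prob P (fun t w => Y (N t w) w) L.
Proof.
move=> Noo e e0; pose B n := [set w | e < `|Y n w - L w|].
have mB n : measurable (B n).
  rewrite -[X in measurable X]setTI; apply: measurable_fun_ltr => //.
  by apply: measurableT_comp => //; exact: measurable_funB.
pose D m := \bigcup_(n in [set n | (m <= n)%N]) B n.
have mD m : measurable (D m) by exact: bigcup_measurable.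
have D0 : P (\bigcap_m D m) = 0%E.
  apply: ae_not_measure0; first exact: bigcapT_measurable.
  apply: filterS YL => w /cvgrPdist_le/(_ _ e0)[m _ Ym] /(_ m I)[n mn].
  by rewrite /B/= ltNge distrC Ym.
have cvgD : P (D m) @[m --> \oo] --> 0%E.
  rewrite -D0; apply: nonincreasing_cvg_mu => //.
  - by rewrite ltey_eq fin_num_measure.
  - exact: bigcapT_measurable.
  - apply/nonincreasing_seqP => m; apply/subsetPset => w [n mn Bn].
    by exists n => //; exact: ltnW.
have mS t : 0 <= t -> measurable [set w | e < `|Y (N t w) w - L w|].
  move=> t0; rewrite (_ : [set w | _] = \bigcup_n (N t @^-1` [set n] `&` B n)).
    apply: bigcupT_measurable => n; apply: measurableI => //.
    by rewrite -[X in measurable X]setTI; exact: mN.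
  apply/seteqP; split => w /=; first by move=> h; exists (N t w).
  by move=> [n _ [/= ->]].
have mNle t m : 0 <= t -> measurable [set w | (N t w)%:R <= m.+1%:R :> R].
  move=> t0; rewrite -[X in measurable X]setTI.
  by apply: (mN t0 measurableT (Y := [set n | n%:R <= m.+1%:R :> R])).
apply/fine_cvgP; split.
  near=> t; apply: fin_num_measure; apply: mS.
  by near: t; exact: nbhs_pinfty_ge.
apply/cvgrPdist_le => r r0; have r2 : 0 < r / 2 by rewrite divr_gt0.
have small (I : Type) (F : set_system I) (FF : Filter F) (f : I -> \bar R) :
    f i @[i --> F] --> 0%E -> \forall i \near F, (f i <= (r / 2)%:E)%E.
  move=> /fine_cvgP[ffin /cvgrPdist_le/(_ _ r2) fr].
  apply: filterS2 ffin fr => i fi /=; rewrite sub0r normrN => h.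
  by rewrite -(fineK fi) lee_fin (le_trans (ler_norm _)).
have [m _ /(_ m.+1)/= DM] := small _ _ _ _ cvgD.
have {}DM := DM (leqnSn m).
have NM := small _ _ _ _ (Noo m.+1%:R (ltr0Sn _ _)).
near=> t; have t0 : 0 <= t by near: t; exact: nbhs_pinfty_ge.
rewrite sub0r normrN ger0_norm ?fine_ge0//= -lee_fin fineK; last first.
  by apply: fin_num_measure; exact: mS.
apply: (@le_trans _ _ (P ([set w | (N t w)%:R <= m.+1%:R :> R] `|` D m.+1))).
  apply: le_measure; rewrite ?inE; first exact: mS.
    by apply: measurableU => //; exact: mNle.
  move=> w /= h; have [Nm|Nm] := leP (N t w)%:R (m.+1%:R : R); [by left|right].
  by exists (N t w) => //=; move: Nm; rewrite ltr_nat => /ltnW.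
apply: le_trans (measureU2 _ _ _) _ => //; first exact: mNle.
rewrite [r]splitr EFinD leeD//.
by near: t; exact: NM.
Unshelve. all: by end_near. Qed.

End random_index.

Theorem theorem4p1 (R : realType) (d : measure_display) (T : measurableType d)
    (P : probability T R) (a : R) (ha : 0 < a)
    (X : nat -> {RV P >-> R}) (hX : strictly_stationary X)
    (k : nat -> nat)
    (hk : forall n : nat, (1 <= n)%N -> (1 <= k n <= n)%N)
    (hk1 : ((k n)%:R / n%:R : R) @[n --> \oo] --> (1 : R))
    (gamma : T -> \bar R)
    (hgamma : is_cond_right_endpoint P (invariant_sigma_field X) (X 0%N) gamma)
    (hP0 : P [set w | (X 0%N w)%:E = gamma w] = 0%E)
    (hPa : P [set w | (X 0%N w)%:E = (gamma w - a%:E)%E] = 0%E)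
    (p : T -> R)
    (hp : is_cond_prob P (invariant_sigma_field X)
            [set w | (gamma w - a%:E < (X 0%N w)%:E)%E] p)
    (N : R -> T -> nat)
    (hN : forall t : R, 0 <= t -> measurable_fun setT (N t)) :
  (* When N t w = 0 the ratio is 0 / 0 = 0. *)
  let ratio (t : R) (w : T) : R :=
    (near_order_stat_count a (fun i => X i w) (N t w) (k (N t w)))%:R
      / (N t w)%:R in
  let limit (w : T) : R := \1_[set v | (gamma v < +oo)%E] w * p w in
  (diverges_as P N -> cvg_as P ratio limit) /\
  (diverges_in_prob P N -> cvg_in_prob P ratio limit).
Proof.
move=> ratio limit.
pose Y n w : R := (near_order_stat_count a (X ^~ w) n (k n))%:R / n%:R.
have YL : {ae P, forall w, Y n w @[n --> \oo] --> limit w}.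
  exact: near_order_stat_ratio_cvg hp.
have mY n : measurable_fun setT (Y n).
  apply: measurable_funM => //.
  apply: measurable_near_order_stat_count => [n1|i].
    exact: hk.
  exact: measurable_funPT.
have mlimit : measurable_fun setT limit.
  apply: measurable_funM; last first.
    by have [_ /measurable_int/measurable_EFinP] := hp.
  apply: measurable_indic; apply: (@invariant_measurable _ _ _ _ X).
  have := right_endpoint_invariant hgamma
    (emeasurable_itv `]-oo, (+oo%E : \bar R)[).
  by rewrite set_itvE; exact.
split; first exact: (cvg_as_random_index YL).
exact: (cvg_in_prob_random_index YL).
Qed.
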